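(* Let $\varepsilon>0$ be a small real number. Let $x>1$ be a large real number and let $p\in[x,2x]$ be a prime number. Then the least stationary primitive root $g_s(p)$ satisfies $$g_s(p)\ll p^{1/2+\varepsilon}\log p$$ as $x\to\infty$, where the implied constant may depend on $\varepsilon$.
   Context: For an integer $g$ coprime to $n$, $\operatorname{ord}_n g$ denotes the multiplicative order of $g$ modulo $n$, and $\varphi$ is Euler's totient function. An integer $g\ge 2$ is a primitive root modulo $n$ if $\operatorname{ord}_n g=\varphi(n)$. For a prime $p$, a stationary primitive root is an integer $g\ge2$ that is simultaneously a primitive root modulo $p$ and a primitive root modulo $p^2$, i.e. $\operatorname{ord}_p g=p-1$ and $\operatorname{ord}_{p^2}g=p(p-1)$. $g_s(p)$ denotes the least such $g$. *)

(* Defs.v *)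
From HB Require Import structures.
From mathcomp Require Import all_boot all_order all_algebra.
From mathcomp Require Import all_fingroup all_solvable all_field.
From mathcomp Require Import zify.

Set Implicit Arguments.
Unset Strict Implicit.
Unset Printing Implicit Defensive.

Import GRing.Theory.

Local Open Scope nat_scope.

Lemma mulord_subproof n g :
  exists k, (0 < k) && (coprime g n ==> (g ^ k == 1 %[mod n])).
Proof.
case: (posnP n) => [->|n0].
  by exists 1; rewrite /coprime gcdn0 expn1; apply/implyP => /eqP ->.
exists (totient n); rewrite totient_gt0 n0 /=.
by apply/implyP => /Euler_exp_totient ->.
Qed.

(* The multiplicative order of g modulo n when g is coprime to n; the value 0
   otherwise is a dummy, and is_primitive_root requires coprimality anyway. *)
Definition mulord (n g : nat) : nat :=
  if coprime g n then ex_minn (mulord_subproof n g) else 0.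

Definition is_primitive_root (n g : nat) : bool :=
  [&& 2 <= g, coprime g n & mulord n g == totient n].

Definition is_stationary_primitive_root (p g : nat) : bool :=
  is_primitive_root p g && is_primitive_root (p ^ 2) g.

Lemma mulord_unique n g d : coprime g n -> 0 < d -> g ^ d = 1 %[mod n] ->
  (forall k, 0 < k -> g ^ k = 1 %[mod n] -> d <= k) -> mulord n g = d.
Proof.
move=> cgn d0 gd dmin; rewrite /mulord; case: ifP; last by rewrite cgn.
move=> _; case: ex_minnP => m; rewrite cgn /= => /andP[m0 /eqP gm] mmin.
apply/eqP; rewrite eqn_leq dmin //.
by rewrite mmin // d0 gd eqxx.
Qed.

Lemma prime_has_generator p : prime p -> exists2 g, coprime g p &
  forall k, g ^ k = 1 %[mod p] -> p.-1 %| k.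
Proof.
move=> pp; have p1 := prime_gt1 pp.
have /cyclicP[u Hu] := field_unit_group_cyclic [set: {unit 'F_p}]%G.
have ou : #[u]%g = p.-1 by rewrite /order -Hu card_finField_unit card_Fp.
have uE : ((val u : 'F_p) : nat)%:R%R = val u.
  by rewrite natr_Zp.
have Hk k : ((val u : 'F_p) : nat) ^ k = 1 %[mod p] -> p.-1 %| k.
  move=> E; rewrite -ou order_dvdn; apply/eqP/val_inj.
  rewrite FinRing.val_unitX -uE -natrX -(Fp_nat_mod pp) E (Fp_nat_mod pp).
  by [].
exists (val u : 'F_p) => //.
rewrite coprime_sym prime_coprime // /dvdn.
rewrite -(val_Fp_nat pp) uE.
have: (val u : 'F_p) != 0%R by rewrite -unitfE; exact: (valP u).
by apply: contra => /eqP h; apply/eqP/val_inj.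
Qed.

Lemma exp_succ_mod_sqr p m : (1 + p) ^ m = 1 + m * p %[mod p ^ 2].
Proof.
elim: m => [|m IHm]; first by rewrite mul0n.
rewrite expnS -modnMmr IHm modnMmr.
have -> : (1 + p) * (1 + m * p) = m * p ^ 2 + (1 + m.+1 * p) by lia.
by rewrite modnMDl.
Qed.

Lemma gs_subproof p : exists g, prime p ==> is_stationary_primitive_root p g.
Proof.
have [pp|_] := boolP (prime p); last by exists 0.
have p1 := prime_gt1 pp; have p0 := prime_gt0 pp.
have [h chp hmin] := prime_has_generator pp.
have h0 : 0 < h.
  by case: h chp {hmin} => //; rewrite /coprime gcd0n => /eqP E; rewrite E in p1.
pose G := h ^ p * (1 + p).
have cGp : coprime G p by rewrite coprimeMl coprimeXl //= add1n coprimeSn.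
have cGpp : coprime G (p ^ 2) by rewrite coprimeXr.
have hp : h ^ p = h %[mod p].
  apply/eqP; rewrite -{1}(prednK p0) expnS -[X in _ == X %[mod p]]muln1.
  by rewrite -modnMmr -totient_prime // Euler_exp_totient // modnMmr.
have Gk k : G ^ k = h ^ k %[mod p].
  rewrite -modnXm -modnMm hp modnDr modnMm muln1 modnXm //.
have Gmin k : G ^ k = 1 %[mod p] -> p.-1 %| k by rewrite Gk; apply: hmin.
have p10 : 0 < p.-1 by rewrite -ltnS prednK.
have pp2 : totient (p ^ 2) = p.-1 * p by rewrite totient_pfactor // expn1.
exists G; apply/implyP => _; rewrite /is_stationary_primitive_root.
rewrite /is_primitive_root cGp cGpp /=.
have -> : 2 <= G.
  by rewrite (leq_trans _ (leq_pmull _ _)) // ?expn_gt0 ?h0 // add1n ltnS.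
rewrite /=; apply/andP; split; apply/eqP; apply: mulord_unique => //.
- by rewrite totient_gt0.
- exact: Euler_exp_totient.
- by rewrite totient_prime // => k k0 /Gmin; apply: dvdn_leq.
- by rewrite totient_gt0 expn_gt0 p0.
- exact: Euler_exp_totient.
move=> k k0 E; rewrite pp2.
have E1 : G ^ k = 1 %[mod p].
  have: G ^ k %% p ^ 2 %% p = 1 %% p ^ 2 %% p by rewrite E.
  by rewrite !modn_dvdm // dvdn_exp.
have /dvdnP[e ek] := Gmin _ E1; subst k.
apply: dvdn_leq => //; rewrite mulnC dvdn_pmul2r //.
have : 1 + e * p.-1 * p = 1 %[mod p ^ 2].
  rewrite -E expnMn -modnMml -expnM.
  have -> : p * (e * p.-1) = totient (p ^ 2) * e.
    by rewrite pp2 mulnCA mulnC [p * _]mulnC.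
  rewrite expnM -modnXm Euler_exp_totient ?coprimeXr // modnXm exp1n modnMml.
  by rewrite mul1n exp_succ_mod_sqr.
move=> /eqP; rewrite -{2}[1]addn0 eqn_modDl mod0n -/(dvdn _ _) -mulnn.
rewrite dvdn_pmul2r // Euclid_dvdM // => /orP[//|/(dvdn_leq p10)].
by rewrite leqNgt prednK // leqnn.
Qed.

(* Only meaningful for p prime: for other p the value is 0. *)
Definition gs (p : nat) : nat := ex_minn (gs_subproof p).

(* Main.v *)
(* Counting x + y over pairs x, y in {1..M} instead of single integers makes the
   distribution in cosets elementary: for a subgroup H of F_p^* the number of
   pairs with x + y in H is M^2 |H| / p up to an error M sqrt p.  Indeed x + y
   lies in H iff k (x + y) does, for every k in H, so that the count is an
   incidence count between the points (k, k x) and the lines b + a y = h (y <= M,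
   h in H); two non-parallel lines meet in exactly one point, which gives the
   variance of the number of lines through a point of F_p^2.
   Sieving over the primes dividing p - 1 yields at least about M^2 / 2^w pairs such that
   x + y is a primitive root mod p, with error 2^w M sqrt p, w being the number
   of these primes.  At most M B pairs have (x + y)^(p-1) = 1 mod p^2, where B
   counts the solutions n <= 2 M of this congruence; products of two solutions
   are less than p^2 and are solutions determined by their residue mod p, so
   that B^2 is at most p times a divisor count.  As 2^w and the divisor counts
   are p^o(1), M = p^(1/2 + o(1)) suffices. *)
Require Import Defs.
From mathcomp Require Import all_boot all_order all_algebra.
From mathcomp Require Import all_solvable all_field.
From mathcomp Require Import all_classical all_reals all_analysis.
From mathcomp Require Import zify ring lra.

Set Implicit Arguments.
Unset Strict Implicit.
Unset Printing Implicit Defensive.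

Import Order.TTheory GRing.Theory Num.Theory.
Import numFieldNormedType.Exports.

(** * Divisor bounds *)

(** With integer division, e + 1 <= k (e/k + 1) <= k 2^(e/k); raise this to the power k. *)
Lemma succ_exp_le k e : 0 < k -> e.+1 ^ k <= k ^ k * 2 ^ e.
Proof.
move=> k0; have le1 : e.+1 <= k * 2 ^ (e %/ k).
  apply: (@leq_trans (k * (e %/ k).+1)); last by rewrite leq_mul2l ltn_expl ?orbT.
  by rewrite mulnC; exact: ltn_ceil.
apply: (@leq_trans ((k * 2 ^ (e %/ k)) ^ k)); first by rewrite leq_exp2r.
by rewrite expnMn -expnM leq_mul2l leq_exp2l // leq_trunc_div orbT.
Qed.

(* The constant depends on k only, since the factor (e+1)^k exceeds r^e only for
   the primes r < 2^k. *)
Lemma submultiplicative_bound (k : nat) : 0 < k -> exists2 C, 0 < C &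
  forall f : nat -> nat, f 1 <= 1 ->
  (forall r e m, prime r -> 0 < e -> coprime r m -> 0 < m ->
     f (r ^ e * m) <= e.+1 * f m) ->
  forall n, 0 < n -> f n ^ k <= C * n.
Proof.
move=> k0; have A0 : 0 < k ^ k by rewrite expn_gt0 k0.
exists ((k ^ k) ^ (2 ^ k)); first by rewrite expn_gt0 A0.
move=> f f1 fM.
(* Induction on a strict bound [b] for the prime factors: only the values of [b] below 2^k cost a
   factor [k ^ k]. *)
suff H b n : 0 < n -> (forall r, prime r -> r %| n -> r < b) ->
    f n ^ k <= (k ^ k) ^ minn b (2 ^ k) * n.
  move=> n n0; apply: leq_trans (H n.+1 n n0 _) _.
    by move=> r _ /(dvdn_leq n0); rewrite ltnS.
  by rewrite leq_mul2r leq_pexp2l ?orbT // geq_minr.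
elim: b n => [|b IH] n n0 bd.
  have [n1|] := leqP n 1; last by move=> /pdivP[r pr /(bd _ pr)].
  have -> : n = 1 by case: n n0 n1 {bd} => [|[]].
  by rewrite min0n muln1 expn0 -[leqRHS](exp1n k) leq_exp2r.
have [/andP[pb bn]|nb] := boolP (prime b && (b %| n)); last first.
  apply: leq_trans (IH n n0 _) _.
    move=> r pr rn; have := bd r pr rn; rewrite ltnS leq_eqVlt => /orP[/eqP rb|//].
    by rewrite -rb pr rn in nb.
  by rewrite leq_mul2r leq_pexp2l ?orbT // geq_min leq_min leqnSn; lia.
have [m bm nE] := pfactor_coprime pb n0; set e := logn b n in nE.
have e0 : 0 < e by rewrite logn_gt0 mem_primes pb n0.
have m0 : 0 < m by move: n0; rewrite nE muln_gt0 => /andP[].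
have IHm : f m ^ k <= (k ^ k) ^ minn b (2 ^ k) * m.
  apply: IH => // r pr rm; have rn : r %| n by rewrite nE dvdn_mulr.
  have := bd r pr rn; rewrite ltnS leq_eqVlt => /orP[/eqP rb|//].
  by move: bm; rewrite -rb prime_coprime // rm.
have {}nE : n = b ^ e * m by rewrite {1}nE mulnC.
rewrite nE; apply: (@leq_trans ((e.+1 * f m) ^ k)).
  by rewrite leq_exp2r // fM.
rewrite expnMn.
(* For b >= 2^k, (e + 1)^k <= 2^(k e) <= b^e, so the constant does not grow. *)
have [kb|bk] := leqP (2 ^ k) b.
  have -> : minn b.+1 (2 ^ k) = minn b (2 ^ k) by lia.
  rewrite [leqRHS]mulnCA leq_mul //.
  apply: (@leq_trans ((2 ^ k) ^ e)); last by rewrite leq_exp2r.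
  by rewrite -expnM mulnC expnM leq_exp2r // ltn_expl.
have -> : minn b.+1 (2 ^ k) = (minn b (2 ^ k)).+1 by lia.
rewrite expnS.
apply: (@leq_trans ((k ^ k * b ^ e) * ((k ^ k) ^ minn b (2 ^ k) * m))).
  apply: leq_mul => //; apply: leq_trans (succ_exp_le e k0) _.
  by rewrite leq_mul2l leq_exp2r ?prime_gt1 ?orbT.
by apply: eq_leq; lia.
Qed.

(** A divisor splits as r^i d with i <= e and d dividing m. This is what [submultiplicative_bound]
    asks of the divisor count. *)
Lemma size_divisors_pfactor_mul r e m : prime r -> coprime r m -> 0 < m ->
  size (divisors (r ^ e * m)) <= e.+1 * size (divisors m).
Proof.
move=> pr rm m0; have r0 := prime_gt0 pr.
rewrite -[e.+1](size_iota 0) -(size_allpairs (fun i d => r ^ i * d)).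
apply: uniq_leq_size; first exact: divisors_uniq.
move=> d; rewrite -dvdn_divisors ?muln_gt0 ?expn_gt0 ?r0 // => dn.
have d0 : 0 < d by apply: dvdn_gt0 dn; rewrite muln_gt0 expn_gt0 r0.
have [m' rm' dE] := pfactor_coprime pr d0.
apply/allpairsP; exists (logn r d, m'); split; last by rewrite {1}dE mulnC.
  rewrite mem_iota /= add0n ltnS -(dvdn_Pexp2l _ _ (prime_gt1 pr)).
  rewrite -(@Gauss_dvdl _ _ m) ?coprimeXl //.
  by apply: dvdn_trans dn; rewrite [X in _ %| X]dE dvdn_mull.
rewrite -dvdn_divisors // -(@Gauss_dvdr _ (r ^ e)); last first.
  by rewrite coprime_sym coprimeXl.
by apply: dvdn_trans dn; rewrite [X in _ %| X]dE dvdn_mulr.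
Qed.

(** At most one new prime appears, and 2 <= e + 1. *)
Lemma exp2_size_primes_pfactor_mul r e m : prime r -> 0 < e -> 0 < m ->
  2 ^ size (primes (r ^ e * m)) <= e.+1 * 2 ^ size (primes m).
Proof.
move=> pr e0 m0; apply: (@leq_trans (2 ^ (size (primes m)).+1)); last first.
  by rewrite expnS leq_mul2r ltnS e0 orbT.
rewrite leq_exp2l // -/(size (r :: primes m)); apply: uniq_leq_size => [|d].
  exact: primes_uniq.
by rewrite primesM ?expn_gt0 ?(prime_gt0 pr) // primesX // primes_prime // !inE.
Qed.

(** * Second moment of incidences; sums of pairs in a subgroup *)

Local Open Scope ring_scope.

(** For distinct y and y', (a, b) -> (b + a y, b + a y') is a bijection of F^2, so the two
    memberships are independent. *)
Lemma card_affine_pencil (F : finFieldType) (H : {set F}) (y y' : F) :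
  (\sum_(a : F) \sum_(b : F) ((b + a * y)%R \in H) * ((b + a * y')%R \in H) =
   if y == y' then #|F| * #|H| else #|H| * #|H|)%N.
Proof.
have shift c : (\sum_(b : F) ((b + c)%R \in H) = #|H|)%N.
  rewrite -sum1_card [RHS]big_mkcond /= (reindex_inj (addIr (- c))) /=.
  by apply: eq_bigr => b _; rewrite subrK; case: (b \in H).
have [->|neq] := eqVneq y y'.
  under eq_bigr => a _ do under eq_bigr => b _ do rewrite mulnb andbb.
  under eq_bigr => a _ do rewrite shift.
  by rewrite sum_nat_const cardE.
have d0 : y' - y != 0 by rewrite subr_eq0 eq_sym.
have inner a : (\sum_(b : F) ((b + a * y)%R \in H) * ((b + a * y')%R \in H) =
    \sum_b (b \in H) * ((b + a * (y' - y))%R \in H))%N.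
  rewrite (reindex_inj (addIr (- (a * y)))) /=.
  by apply: eq_bigr => b _; rewrite subrK mulrBr addrAC addrA.
under eq_bigr => a _ do rewrite inner.
rewrite exchange_big /=.
under eq_bigr => b _.
  rewrite -big_distrr /= (reindex_inj (mulIf (invr_neq0 d0))) /=.
  under eq_bigr => a _ do rewrite mulfVK // addrC.
  by rewrite shift; over.
have sumH : (\sum_(b : F) (b \in H) = #|H|)%N.
  by rewrite -[RHS](shift 0); apply: eq_bigr => b _; rewrite addr0.
by rewrite -big_distrl /= sumH.
Qed.

(** Cauchy-Schwarz, from the nonnegativity of the sum of (f i - f j)^2 over i, j in A. *)
Lemma sqr_sum_le_card (R : realDomainType) (I : finType) (A : {set I}) (f : I -> R) :
  (\sum_(i in A) f i) ^+ 2 <= #|A|%:R * \sum_(i in A) f i ^+ 2.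
Proof.
set n : R := #|A|%:R; set S1 := \sum_(i in A) f i; set S2 := \sum_(i in A) f i ^+ 2.
have inner i : \sum_(j in A) (f i - f j) ^+ 2 = n * f i ^+ 2 - 2 * S1 * f i + S2.
  under eq_bigr => j _ do rewrite sqrrB.
  rewrite big_split /= sumrB sumr_const sumrMnl -mulr_sumr -/S1 -/S2.
  by rewrite -[_ *+ #|A|]mulr_natl -/n; ring.
have E : \sum_(i in A) \sum_(j in A) (f i - f j) ^+ 2 = (n * S2 - S1 ^+ 2) *+ 2.
  under eq_bigr => i _ do rewrite inner.
  rewrite big_split /= sumrB sumr_const -!mulr_sumr -/S1 -/S2.
  by rewrite -[_ *+ #|A|]mulr_natl -/n; ring.
have : 0 <= \sum_(i in A) \sum_(j in A) (f i - f j) ^+ 2.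
  by apply: sumr_ge0 => i _; apply: sumr_ge0 => j _; apply: sqr_ge0.
by rewrite E pmulrn_lge0 // subr_ge0.
Qed.

(** With q = |F|, the squared deviations of [nu] from its mean add up to at most q |J| |H| over F^2.
    Each x in J gives |H| points (k, k x) with the same value of [nu], so the squares over J add up
    to at most q |J|; Cauchy-Schwarz concludes. *)
Lemma sum_pairs_subgroup (R : realFieldType) (F : finFieldType) (H J : {set F}) :
  (0 < #|H|)%N -> {in H, forall h, h != 0} -> {in H, forall h x, (h * x \in H) = (x \in H)} ->
  (\sum_(x in J) \sum_(y in J) (x + y \in H)%:R - #|J|%:R ^+ 2 * #|H|%:R / #|F|%:R) ^+ 2
    <= #|F|%:R * #|J|%:R ^+ 2 :> R.
Proof.
move=> H0 Hn0 HM; set q : R := #|F|%:R; set j : R := #|J|%:R; set h : R := #|H|%:R.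
have q0 : 0 < q by rewrite ltr0n; apply/card_gt0P; exists 0.
have h0 : 0 < h by rewrite ltr0n.
pose mean := j * h / q.
pose nu (a b : F) : R := \sum_(y in J) (b + a * y \in H)%:R.
have shift c : \sum_b (b + c \in H)%:R = h.
  rewrite (reindex_inj (addIr (- c))) /=; under eq_bigr => b _ do rewrite subrK.
  by rewrite /h -sum1_card natr_sum [RHS]big_mkcond; apply: eq_bigr => b _; case: (b \in H).
have sum_nu a : \sum_b nu a b = j * h.
  rewrite exchange_big /=; under eq_bigr => y _ do rewrite shift.
  by rewrite sumr_const -mulr_natl.
have sum_nu2 : \sum_a \sum_b nu a b ^+ 2 = j * (q * h) + (j ^+ 2 - j) * h ^+ 2.
  have -> : \sum_a \sum_b nu a b ^+ 2 = \sum_(y in J) \sum_(y' in J)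
     (\sum_(a : F) \sum_(b : F) ((b + a * y)%R \in H) * ((b + a * y')%R \in H))%N%:R.
    under eq_bigr => a _ do under eq_bigr => b _ do rewrite expr2 big_distrlr /=.
    under eq_bigr => a _ do rewrite exchange_big /=.
    rewrite exchange_big /=; apply: eq_bigr => y _.
    under eq_bigr => a _ do rewrite exchange_big /=.
    rewrite exchange_big /=; apply: eq_bigr => y' _.
    rewrite natr_sum; apply: eq_bigr => a _; rewrite natr_sum.
    by apply: eq_bigr => b _; rewrite natrM.
  under eq_bigr => y Jy.
    rewrite (bigD1 y Jy) /= card_affine_pencil eqxx.
    under eq_bigr => y' /andP[_ yy'] do rewrite card_affine_pencil eq_sym (negPf yy').
    rewrite sumr_const.
    have -> : #|[pred i in J | i != y]| = #|J|.-1.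
      by rewrite (cardsD1 y J) Jy /=; apply: eq_card => z; rewrite !inE andbC.
    over.
  rewrite sumr_const -[LHS]mulr_natl -[_ *+ #|J|.-1]mulr_natl !natrM -/q -/h -/j.
  (* For empty [J] the truncated [#|J|.-1] is not |J| - 1. *)
  case: (posnP #|J|) => [J0|J0]; first by rewrite /j J0; ring.
  have -> : #|J|.-1%:R = j - 1 by rewrite -[j]/(_%:R) -{2}(prednK J0) -natr1 addrK.
  by ring.
have sumc (c : R) : \sum_(a : F) c = q * c by rewrite sumr_const -mulr_natl.
have var : \sum_a \sum_b (nu a b - mean) ^+ 2 <= q * (j * h).
  have -> : \sum_a \sum_b (nu a b - mean) ^+ 2 =
     \sum_a \sum_b nu a b ^+ 2 - mean *+ 2 * (\sum_a \sum_b nu a b) + q ^+ 2 * mean ^+ 2.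
    rewrite mulr_sumr expr2 -mulrA -sumc -sumrB -big_split /=; apply: eq_bigr => a _.
    rewrite mulr_sumr -sumc -sumrB -big_split /=; apply: eq_bigr => b _.
    by rewrite sqrrB; ring.
  rewrite sum_nu2; under eq_bigr => a _ do rewrite sum_nu.
  rewrite sumc.
  have -> : q ^+ 2 * mean ^+ 2 = (j * h) ^+ 2 by rewrite /mean; field; rewrite gt_eqF.
  have -> : mean *+ 2 * (q * (j * h)) = (j * h) ^+ 2 *+ 2 by rewrite /mean; field; rewrite gt_eqF.
  have : 0 <= j * h ^+ 2 by rewrite mulr_ge0 // ?sqr_ge0 // ler0n.
  nra.
pose r (x : F) : R := \sum_(y in J) (x + y \in H)%:R.
(* Only the points (k, k x) with k in H and x in J are kept; there [nu] equals [r x], since k (x +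
   y) lies in H exactly when x + y does. *)
have var_r : h * (\sum_(x in J) (r x - mean) ^+ 2) <= q * (j * h).
  apply: le_trans var; rewrite [h * _]mulr_natl -sumr_const.
  rewrite [leRHS](bigID (mem H)) /= -[leLHS]addr0; apply: lerD; last first.
    by apply: sumr_ge0 => a _; apply: sumr_ge0 => b _; apply: sqr_ge0.
  apply: ler_sum => k Hk; have k0 := Hn0 _ Hk.
  rewrite [leRHS](reindex_inj (mulfI k0)) /= [leRHS](bigID (mem J)) /=.
  rewrite -[leLHS]addr0; apply: lerD; last by apply: sumr_ge0 => b _; apply: sqr_ge0.
  rewrite le_eqVlt; apply/orP; left; apply/eqP; apply: eq_bigr => x _.
  by congr ((_ - _) ^+ 2); apply: eq_bigr => y _; rewrite -mulrDr HM.
have -> : \sum_(x in J) r x - j ^+ 2 * h / q = \sum_(x in J) (r x - mean).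
  by rewrite sumrB sumr_const -mulr_natl -/j /mean; ring.
apply: (le_trans (sqr_sum_le_card _ _)).
rewrite -/j [j ^+ 2]expr2 mulrCA ler_wpM2l // ?ler0n //.
rewrite -(ler_pM2l h0).
by have -> : h * (q * j) = q * (j * h) by ring.
Qed.

(** * Roots of unity and the sieve over primes dividing |F| - 1 *)

(** A suitable power of a generator of the multiplicative group is a primitive n-th root of unity,
    whose powers are all the solutions. *)
Lemma card_unity_roots (F : finFieldType) (n : nat) :
  (n %| #|F|.-1)%N -> #|[set x : F | x ^+ n == 1]| = n.
Proof.
move=> nQ; have Q0 : (0 < #|F|.-1)%N by rewrite -subn1 subn_gt0 finNzRing_gt1.
have n0 : (0 < n)%N by apply: dvdn_gt0 nQ.
have /hasP[z _ zprim] : has #|F|.-1.-primitive_root (enum [set x : F | x != 0]).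
  have cardU : size (enum [set x : F | x != 0]) = #|F|.-1.
    by rewrite -cardE cardsE -(cardC1 (0 : F)); apply: eq_card => x; rewrite !inE.
  apply: has_prim_root => //; rewrite ?enum_uniq ?cardU //.
  apply/allP => x; rewrite mem_enum inE => x0; rewrite unity_rootE.
  by rewrite -subn1 -(inj_eq (mulfI x0)) -exprS subn1 prednK ?mulr1 ?expf_card ?eqxx //;
     rewrite (ltn_trans _ (finNzRing_gt1 F)).
have wprim := dvdn_prim_root zprim nQ; set w := z ^+ _ in wprim.
rewrite -[RHS](card_ord n) -(card_imset (@predT 'I_n) (f := fun i : 'I_n => w ^+ i)).
  apply: eq_card => x; rewrite inE; apply/eqP/imsetP => [/(prim_rootP wprim)[i ->]|[i _ ->]].
    by exists i.
  by rewrite exprAC (prim_expr_order wprim) expr1n.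
by move=> i j /eqP; rewrite (eq_prim_root_expr wprim) !modn_small // => /eqP/val_inj.
Qed.

Lemma expr_coprime_eq1 (R : pzRingType) (w : R) (m r : nat) :
  coprime m r -> w ^+ m = 1 -> w ^+ r = 1 -> w = 1.
Proof.
have [->|m0] := posnP m; first by rewrite /coprime gcd0n => /eqP -> _; rewrite expr1.
move=> /eqP mr wm wr; case: (egcdnP r m0) => km kn; rewrite mr => E _.
have : w ^+ (km * m) = w ^+ (kn * r + 1) by rewrite E.
by rewrite mulnC exprM wm expr1n exprD mulnC exprM wr expr1n expr1 mul1r.
Qed.

(** Merges two conditions of the sieve: if both hold on the right, z^(Q/(m r)) has m-th and r-th
    power 1, so [expr_coprime_eq1] applies. *)
Lemma expr_div_mul_eq1 (R : pzRingType) (z : R) (Q m r : nat) :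
  coprime m r -> (m * r %| Q)%N -> (0 < m)%N -> (0 < r)%N ->
  (z ^+ (Q %/ (m * r)) == 1) = (z ^+ (Q %/ m) == 1) && (z ^+ (Q %/ r) == 1).
Proof.
move=> mr /dvdnP[t ->] m0 r0; rewrite mulnK ?muln_gt0 ?m0 //.
rewrite [in (_ %/ m)%N]mulnCA mulKn // mulnA mulnK //.
apply/eqP/andP => [zt|[/eqP ztr /eqP ztm]]; first by rewrite !exprM zt !expr1n.
by apply: (expr_coprime_eq1 mr); rewrite -exprM.
Qed.

(** Here z^(Q/m) = 1 says that z is a nonzero m-th power, and [S] replaces sqrt |F|. The parameter m
    serves the induction on s: the count for (m, r :: s) is that for (m, s) minus that for (m r, s),
    so each prime doubles the error. *)
Lemma sum_pairs_sieve (R : realFieldType) (F : finFieldType) (J : {set F}) (S : R)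
    (s : seq nat) (m : nat) :
  let Q := #|F|.-1 in
  0 <= S -> #|F|%:R <= S ^+ 2 ->
  uniq s -> all prime s -> all (coprime m) s -> (0 < m)%N -> (m * \prod_(r <- s) r %| Q)%N ->
  `| \sum_(x in J) \sum_(y in J)
       (((x + y) ^+ (Q %/ m) == 1) && all (fun r => (x + y) ^+ (Q %/ r) != 1) s)%:R
     - #|J|%:R ^+ 2 * Q%:R / (#|F|%:R * m%:R) * \prod_(r <- s) (1 - r%:R^-1) |
  <= 2 ^+ size s * (S * #|J|%:R).
Proof.
move=> Q S0 qS; elim: s m => [|r s IH] m.
  move=> _ _ _ m0; rewrite big_nil muln1 => mQ.
  pose H := [set z : F | z ^+ (Q %/ m) == 1].
  have Qm0 : (0 < Q %/ m)%N.
    by rewrite divn_gt0 // dvdn_leq // /Q -subn1 subn_gt0 finNzRing_gt1.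
  have cardH : #|H| = (Q %/ m)%N.
    by apply: card_unity_roots; rewrite -[X in (_ %| X)%N](divnK mQ) dvdn_mulr.
  have := @sum_pairs_subgroup R F H J; rewrite cardH => /(_ Qm0).
  have Hn0 : {in H, forall h, h != 0}.
    move=> h; rewrite inE; apply: contraTneq => ->.
    by rewrite expr0n eqn0Ngt Qm0 eq_sym oner_eq0.
  have HM : {in H, forall h x, (h * x \in H) = (x \in H)}.
    by move=> h; rewrite inE => /eqP hQ x; rewrite !inE exprMn hQ mul1r.
  move=> /(_ Hn0 HM) le2; rewrite big_nil mulr1 expr0 mul1r.
  rewrite -ler_sqr ?nnegrE ?mulr_ge0 // real_normK ?num_real // exprMn.
  apply: le_trans (ler_wpM2r (sqr_ge0 _) qS); apply: le_trans le2.
  rewrite le_eqVlt; apply/orP; left; apply/eqP; congr ((_ - _) ^+ 2).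
    by apply: eq_bigr => x _; apply: eq_bigr => y _; rewrite inE andbT.
  by rewrite natf_div // invfM; ring.
rewrite /= => /andP[rs us] /andP[pr ps] /andP[mr ms] m0; rewrite big_cons => mQ.
have r0 := prime_gt0 pr.
have mrQ : (m * r %| Q)%N by apply: dvdn_trans mQ; rewrite mulnA dvdn_mulr.
have mrs : all (coprime (m * r)) s.
  apply/allP => t ts; rewrite coprimeMl (allP ms) //=.
  rewrite prime_coprime // dvdn_prime2 ?(allP ps t ts) //.
  by apply: contraNneq rs => ->.
have mr0 : (0 < m * r)%N by rewrite muln_gt0 m0.
have mrsQ : (m * r * \prod_(t <- s) t %| Q)%N by rewrite -mulnA.
have msQ : (m * \prod_(t <- s) t %| Q)%N.
  by apply: dvdn_trans mQ; rewrite dvdn_mul // dvdn_mull.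
have {msQ} IH1 := IH m us ps ms m0 msQ.
have {IH mrsQ} IH2 := IH (m * r)%N us ps mrs mr0 mrsQ.
have split : forall z : F,
  ((z ^+ (Q %/ m) == 1) && ((z ^+ (Q %/ r) != 1) && all (fun r => z ^+ (Q %/ r) != 1) s))%:R
  = ((z ^+ (Q %/ m) == 1) && all (fun r => z ^+ (Q %/ r) != 1) s)%:R
    - ((z ^+ (Q %/ (m * r)) == 1) && all (fun r => z ^+ (Q %/ r) != 1) s)%:R :> R.
  move=> z; rewrite expr_div_mul_eq1 //.
  by case: (_ == 1); case: (_ == 1); case: (all _ _); rewrite /= ?subrr ?subr0.
under eq_bigr => x _ do under eq_bigr => y _ do rewrite split.
under eq_bigr => x _ do rewrite sumrB.
rewrite sumrB big_cons.
set N1 := (X in X - _ - _); set N2 := (X in _ - X - _).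
have -> : N1 - N2 - #|J|%:R ^+ 2 * Q%:R / (#|F|%:R * m%:R) *
     ((1 - r%:R^-1) * \prod_(r <- s) (1 - r%:R^-1)) =
   (N1 - #|J|%:R ^+ 2 * Q%:R / (#|F|%:R * m%:R) * \prod_(r <- s) (1 - r%:R^-1)) -
   (N2 - #|J|%:R ^+ 2 * Q%:R / (#|F|%:R * (m * r)%:R) * \prod_(r <- s) (1 - r%:R^-1)).
  by rewrite natrM !invfM; ring.
apply: le_trans (ler_normB _ _) _.
have -> : 2 ^+ (size s).+1 * (S * #|J|%:R) =
  2 ^+ size s * (S * #|J|%:R) + 2 ^+ size s * (S * #|J|%:R) by rewrite exprS; ring.
exact: lerD.
Qed.

(** * Small solutions of a^(p-1) = 1 modulo p^2 *)

(** a^p - b^p is (a - b) times a sum of p terms, all congruent to b^(p-1) modulo p; both factors are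
    multiples of p. *)
Lemma expn_mod_sqr (p a b : nat) :
  (a = b %[mod p] -> a ^ p = b ^ p %[mod p ^ 2])%N.
Proof.
wlog ba : a b / (b <= a)%N => [H ab|/eqP].
  by have [|/ltnW] := leqP b a => /H -> //; apply/esym.
have [->|p0] := posnP p; first by [].
rewrite eqn_mod_dvd // => pab.
apply/eqP; rewrite eqn_mod_dvd ?leq_exp2r // subn_exp -mulnn dvdn_mul //.
have aE : (a = b %[mod p])%N by apply/eqP; rewrite eqn_mod_dvd.
have E i : (i < p)%N -> (a ^ (p.-1 - i) * b ^ i = b ^ p.-1 %[mod p])%N.
  move=> ip; rewrite -modnMml -modnXm aE modnXm modnMml -expnD subnK //.
  by rewrite -ltnS prednK.
rewrite /dvdn -modn_summ (eq_bigr (fun=> b ^ p.-1 %% p))%N.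
  by rewrite sum_nat_const card_ord modnMr.
by move=> i _; apply: E.
Qed.

(** A product c of two elements of A has c^p = c modulo p^2 and c < p^2, so its residue modulo p
    determines it by [expn_mod_sqr]. Hence A x A splits into at most p classes of constant product,
    in which a pair is determined by its first entry, a divisor of that product. *)
Lemma sqr_card_small_fermat_quotient (p N D : nat) (A : {set 'I_N}) :
  (1 < p)%N -> (N.-1 ^ 2 < p ^ 2)%N ->
  {in A, forall a : 'I_N, a ^ p.-1 = 1 %[mod p ^ 2]}%N ->
  (forall n, 0 < n < p ^ 2 -> size (divisors n) <= D)%N ->
  (#|A| ^ 2 <= p * D)%N.
Proof.
move=> p1 Np AH HD; have p0 := ltnW p1.
have ltab (a b : 'I_N) : (a * b < p ^ 2)%N.
  apply: leq_ltn_trans Np; rewrite -mulnn leq_mul // -ltnS;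
  by rewrite (ltn_predK (ltn_ord a)).
have fixp (a b : 'I_N) : a \in A -> b \in A -> ((a * b) ^ p = a * b %[mod p ^ 2])%N.
  move=> /AH aA /AH bA.
  have abQ : ((a * b) ^ p.-1 = 1 %[mod p ^ 2])%N.
    by rewrite expnMn -modnMm aA bA modnMm.
  have -> : ((a * b) ^ p = (a * b) ^ p.-1 * (a * b))%N by rewrite -expnSr prednK.
  by rewrite -modnMml abQ modnMml mul1n.
have pos (a : 'I_N) : a \in A -> (0 < a)%N.
  move=> /AH aA; rewrite lt0n; apply/eqP => a0; move: aA.
  have p21 : (1 < p ^ 2)%N by rewrite -(exp1n 2) ltn_exp2r.
  by rewrite a0 exp0n ?mod0n ?modn_small // -subn1 subn_gt0.
rewrite -mulnn -cardsX -sum1_card.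
have pij (ij : 'I_N * 'I_N) : ((ij.1 * ij.2) %% p < p)%N by rewrite ltn_mod.
rewrite (partition_big (fun ij => Ordinal (pij ij)) xpredT) //=.
rewrite -[X in (_ <= X * _)%N]card_ord -sum_nat_const; apply: leq_sum => c _.
have [/pred0P E|/pred0Pn[[a b] /andP[abA abc]]] :=
    boolP (pred0b [pred ij | (ij \in finset.setX A A) && (Ordinal (pij ij) == c)]).
  by rewrite big_pred0.
have {abA} [aA bA] : a \in A /\ b \in A by move: abA; rewrite inE => /andP[].
apply: (@leq_trans (size (divisors (a * b)))); last first.
  by apply: HD; rewrite ltab muln_gt0 !pos.
rewrite sum1_card cardE -(size_map (fun ij : 'I_N * 'I_N => ij.1 : nat)).
have same ij : (ij \in finset.setX A A) && (Ordinal (pij ij) == c) -> (ij.1 * ij.2 = a * b)%N.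
  case: ij => i j; rewrite inE => /andP[/andP[/= iA jA] /eqP ijc].
  have /expn_mod_sqr : (i * j = a * b %[mod p])%N.
    by move/eqP: abc => abc; have /(congr1 val) := etrans ijc (esym abc).
  by rewrite fixp // fixp // !modn_small.
apply: uniq_leq_size.
  rewrite map_inj_in_uniq ?enum_uniq // => -[i j] [i' j'].
  rewrite !mem_enum => Hij Hij' /= /val_inj ii'.
  have /eqP := etrans (same _ Hij) (esym (same _ Hij')).
  rewrite /= -ii' eqn_pmul2l; first by move=> /eqP/val_inj ->.
  by apply: pos; case/andP: Hij; rewrite inE => /andP[].
move=> d /mapP[[i j]]; rewrite mem_enum => /same /= E ->.
by rewrite -dvdn_divisors ?muln_gt0 ?pos // -E dvdn_mulr.
Qed.

(** * Criteria for primitive roots *)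

Lemma expn_eq1_mod_Fp (p n k : nat) : prime p ->
  (n ^ k == 1 %[mod p])%N = ((n%:R : 'F_p) ^+ k == 1).
Proof.
move=> pp; rewrite -natrX -[X in _ = (_ == X)]/(1%:R) -(inj_eq (@ord_inj _)).
by rewrite !val_Fp_nat.
Qed.

Lemma primitive_root_criterion (R : nzRingType) (z : R) (Q : nat) :
  (0 < Q)%N -> z ^+ Q = 1 -> (forall r, prime r -> (r %| Q)%N -> z ^+ (Q %/ r) != 1) ->
  Q.-primitive_root z.
Proof.
move=> Q0 zQ1 H; have [m mz /dvdnP[t E]] := prim_order_exists Q0 zQ1.
have [t1|] := leqP t 1.
  by case: t E t1 => [|[|//]] E _; [rewrite E in Q0 | rewrite E mul1n].
move=> /pdivP[r pr /dvdnP[u tE]]; have r0 := prime_gt0 pr.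
have QE : Q = (u * m * r)%N by rewrite E tE mulnAC.
move: (H r pr); rewrite QE dvdn_mull // mulnK // => /(_ isT).
by rewrite -(prim_order_dvd mz) dvdn_mull.
Qed.

(** Write n^(p-1) = 1 + t p with p not dividing t. Then n^((p-1) e) = 1 + t e p modulo p^2, and this
    is 1 only if p divides e. *)
Lemma stationary_criterion (p n : nat) : prime p -> (1 < n)%N -> coprime n p ->
  (forall r, prime r -> (r %| p.-1)%N -> (n%:R : 'F_p) ^+ (p.-1 %/ r) != 1) ->
  (n ^ p.-1 != 1 %[mod p ^ 2])%N -> is_stationary_primitive_root p n.
Proof.
move=> pp n1 cnp Hr Hs; have p0 := prime_gt0 pp; have p1 := prime_gt1 pp.
have Q0 : (0 < p.-1)%N by rewrite -subn1 subn_gt0.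
have cnp2 : coprime n (p ^ 2) by rewrite coprimeXr.
have pp2 : totient (p ^ 2) = (p.-1 * p)%N by rewrite totient_pfactor // expn1.
have nQ : (n ^ p.-1 == 1 %[mod p])%N.
  by rewrite -totient_prime // Euler_exp_totient.
have zprim : p.-1.-primitive_root (n%:R : 'F_p).
  apply: primitive_root_criterion => //.
  by apply/eqP; rewrite -expn_eq1_mod_Fp.
have dvdQ k : (n ^ k = 1 %[mod p])%N -> (p.-1 %| k)%N.
  by move/eqP; rewrite (prim_order_dvd zprim) -expn_eq1_mod_Fp.
rewrite /is_stationary_primitive_root /is_primitive_root n1 cnp cnp2 /=.
apply/andP; split; apply/eqP; apply: mulord_unique => //.
- by rewrite totient_gt0.
- exact: Euler_exp_totient.
- by rewrite totient_prime // => k k0 /dvdQ; apply: dvdn_leq.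
- by rewrite totient_gt0 expn_gt0 p0.
- exact: Euler_exp_totient.
move=> k k0 E; rewrite pp2.
have E1 : (n ^ k = 1 %[mod p])%N.
  have: (n ^ k %% p ^ 2 %% p = 1 %% p ^ 2 %% p)%N by rewrite E.
  by rewrite !modn_dvdm // dvdn_exp.
have /dvdnP[e ek] := dvdQ _ E1; subst k.
apply: dvdn_leq => //; rewrite mulnC dvdn_pmul2r //.
have nQ1 : (0 < n ^ p.-1)%N by rewrite expn_gt0 (ltnW n1).
move: nQ; rewrite eqn_mod_dvd // => /dvdnP[t Et].
have {}Et : (n ^ p.-1 = 1 + t * p)%N by rewrite -Et subnKC.
have tp : ~~ (p %| t)%N.
  apply: contra Hs; rewrite Et -[X in _ == X %[mod _]]addn0 eqn_modDl mod0n.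
  by rewrite -mulnn => ?; rewrite -/(dvdn _ _) dvdn_pmul2r.
move: E; rewrite mulnC expnM Et => E.
have : (1 + t * e * p = 1 %[mod p ^ 2])%N.
  rewrite -E; elim: {E k0 E1} e => [|e IH]; first by rewrite muln0.
  rewrite (expnS _ e) -modnMmr -IH modnMmr.
  have -> : ((1 + t * p) * (1 + t * e * p) = t * t * e * p ^ 2 + (1 + t * e.+1 * p))%N by lia.
  by rewrite modnMDl.
move=> /eqP; rewrite -{2}[1%N]addn0 eqn_modDl mod0n -/(dvdn _ _) -mulnn.
by rewrite dvdn_pmul2r // Euclid_dvdM // (negPf tp).
Qed.

(** * Comparison of the two counts; bounds for [gs] *)

(** If [gs p] exceeded 2 M, every x + y that is a primitive root modulo p would solve n^(p-1) = 1
    modulo p^2. Then M^2 / (2 D) - D S M <= M S D, contrary to M > 4 D^2 S. *)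
Lemma gs_le_double (p D S M : nat) : prime p -> (p <= S ^ 2)%N ->
  (2 ^ size (primes p.-1) <= D)%N ->
  (forall n, 0 < n < p ^ 2 -> size (divisors n) <= D)%N ->
  (2 * M < p)%N -> (4 * D ^ 2 * S < M)%N -> (gs p <= 2 * M)%N.
Proof.
move=> pp pS wD dD Mp DM; rewrite leqNgt; apply/negP => Mgs.
have p0 := prime_gt0 pp; have p1 := prime_gt1 pp.
have gs_min n : is_stationary_primitive_root p n -> (2 * M < n)%N.
  move=> sn; apply: leq_trans Mgs _; rewrite /gs; case: ex_minnP => m _; apply.
  by rewrite sn implybT.
have Q0 : (0 < p.-1)%N by rewrite -subn1 subn_gt0.
pose s := primes p.-1; pose J := [set x : 'F_p | (0 < x <= M)%N].
have cF : #|'F_p| = p by rewrite card_Fp.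
have cJ : #|J| = M.
  have ltM (i : 'I_M) : (i.+1 < p)%N by have := ltn_ord i; lia.
  have valF (i : 'I_M) : (i.+1%:R : 'F_p) = i.+1 :> nat.
    by rewrite val_Fp_nat // modn_small.
  rewrite -[RHS]card_ord -(card_imset (@predT 'I_M) (f := fun i : 'I_M => i.+1%:R : 'F_p)).
    apply: eq_card => x; rewrite inE; apply/idP/imsetP => [/andP[x0 xM]|[i _ ->]].
      have xM' : (x.-1 < M)%N by lia.
      exists (Ordinal xM') => //; apply/ord_inj; rewrite valF /=; lia.
    by rewrite valF /=.
  by move=> i j /(congr1 (@nat_of_ord _)); rewrite !valF => -[/ord_inj].
pose good (z : 'F_p) := (z ^+ (#|'F_p|.-1 %/ 1) == 1) &&
  all (fun r => z ^+ (#|'F_p|.-1 %/ r) != 1) s.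
pose A := [set a : 'I_(2 * M).+1 | (a ^ p.-1 == 1 %[mod p ^ 2])%N].
(* |A|^2 <= p D <= S^2 D^2. *)
have cA : (#|A| <= S * D)%N.
  rewrite -(@leq_exp2r _ _ 2) // expnMn.
  apply: (@leq_trans (p * D)); last by rewrite leq_mul // -mulnn leq_pmulr //
    (leq_trans _ wD) // expn_gt0.
  apply: (@sqr_card_small_fermat_quotient p (2 * M).+1) => //.
    by rewrite ltn_exp2r.
  by move=> a; rewrite inE => /eqP.
(* For fixed x, y -> x + y injects the good y into [A]. *)
have upper : \sum_(x in J) \sum_(y in J) (good (x + y))%:R <= (M * (S * D))%N%:R :> rat.
  rewrite -cJ -sum_nat_const natr_sum; apply: ler_sum => x Jx.
  apply: (@le_trans _ _ #|A|%:R); last by rewrite ler_nat.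
  rewrite -natr_sum ler_nat -big_mkcondr sum1dep_card.
  (* The value 0 outside [J] is a dummy that keeps the map in range. *)
  have ltxy (y : 'F_p) : ((if y \in J then x + y else 0)%N < (2 * M).+1)%N.
    by case: ifP; rewrite ltnS // => Jy; move: Jx Jy; rewrite !inE; lia.
  rewrite -(card_in_imset (f := fun y => Ordinal (ltxy y))); last first.
    move=> y y'; rewrite inE => /andP[Jy _]; rewrite inE => /andP[Jy' _] /(congr1 val) /=.
    by rewrite Jy Jy' => /addnI/ord_inj.
  apply/subset_leq_card/fintype.subsetP => _ /imsetP[y + ->]; rewrite inE => /andP[Jy gxy].
  rewrite inE /= Jy; move: Jy.
  move: Jx; rewrite inE => /andP[x0 xM]; rewrite inE => /andP[y0 yM].
  apply: contraT => nfermat; suff: (2 * M < x + y)%N by lia.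
  move: gxy; rewrite /good cF => /andP[_ /allP gxy].
  have xyE : ((x + y)%N%:R : 'F_p) = x + y by rewrite natrD !natr_Zp.
  apply: gs_min; apply: stationary_criterion => //; first by lia.
    by rewrite coprime_sym prime_coprime // gtnNdvd //; lia.
  by move=> r pr rQ; rewrite xyE; apply: gxy; rewrite mem_primes pr Q0.
have lower := @sum_pairs_sieve rat 'F_p J S%:R s 1 (ler0n _ _).
have pr_s : all prime s by apply/allP => r; rewrite mem_primes => /andP[].
have prods : (1 * \prod_(r <- s) r %| #|'F_p|.-1)%N.
  rewrite mul1n cF [X in (_ %| X)%N](prod_prime_decomp Q0) prime_decompE big_map.
  rewrite big_seq [X in (_ %| X)%N]big_seq.
  elim/big_ind2: _ => // [? ? ? ?|r rs]; first exact: dvdn_mul.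
  by rewrite /= dvdn_exp // logn_gt0.
move: lower; rewrite cF in prods *; rewrite -natrX ler_nat => /(_ pS (primes_uniq _) pr_s _ isT prods).
have c1 : all (coprime 1) s by apply/allP => r _; rewrite coprime1n.
move=> /(_ c1); rewrite ler_norml => /andP[lower _].
(* Each factor 1 - 1/r is at least 1/2. *)
have prod_ge : (2 ^+ size s)^-1 <= \prod_(r <- s) (1 - r%:R^-1) :> rat.
  rewrite -exprVn; elim: (s) pr_s => [|r t IH] /=; first by rewrite big_nil.
  move=> /andP[pr pt]; rewrite exprS big_cons ler_pM ?invr_ge0 ?exprn_ge0 ?invr_ge0 ?ler0n ?IH //.
  have : (r%:R^-1 : rat) <= 2^-1 by rewrite lef_pV2 ?posrE ?ltr0n ?prime_gt0 // ler_nat prime_gt1.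
  lra.
rewrite /good cF in upper; move: (le_trans lower (lerD upper (lexx _))) => {lower upper}.
rewrite cJ mulr1; set P := \prod_(r <- s) _ => ineq.
have D0 : (0 < D)%N by apply: leq_trans wD; rewrite expn_gt0.
have DR : 1 <= D%:R :> rat by rewrite ler1n.
have wR : 2 ^+ size s <= D%:R :> rat by rewrite -natrX ler_nat.
have PD : D%:R^-1 <= P.
  by apply: le_trans prod_ge; rewrite lef_pV2 ?posrE ?exprn_gt0 ?ltr0n.
have half : 2^-1 <= p.-1%:R / p%:R :> rat.
  rewrite ler_pdivlMr ?ltr0n // mulrC ler_pdivrMr // -natrM ler_nat; lia.
have M0 : 0 < M%:R :> rat by rewrite ltr0n (leq_ltn_trans _ DM).
have main : M%:R ^+ 2 * (2^-1 * D%:R^-1) <= M%:R ^+ 2 * p.-1%:R / p%:R * P.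
  rewrite -2!mulrA [X in _ <= _ * X]mulrA ler_wpM2l ?sqr_ge0 //.
  by rewrite ler_pM ?invr_ge0 ?ler0n.
have err : 2 ^+ size s * (S%:R * M%:R) <= D%:R * (S%:R * M%:R) :> rat.
  by rewrite ler_wpM2r // mulr_ge0 ?ler0n.
have : M%:R ^+ 2 * (2^-1 * D%:R^-1) <= 2 * D%:R * S%:R * M%:R :> rat.
  by move: ineq main err; rewrite !natrM; lra.
rewrite -invfM ler_pdivrMr ?mulr_gt0 ?ltr0n // expr2.
have -> : 2 * D%:R * S%:R * M%:R * (2 * D%:R) = (4 * D ^ 2 * S)%N%:R * M%:R :> rat.
  by rewrite !natrM; ring.
by rewrite ler_pM2r // ler_nat leqNgt DM.
Qed.

(** The least S with n <= S^2 has (S - 1)^2 < n, and S <= 2 (S - 1) unless S = 1. It is an integer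
    substitute for sqrt n. *)
Lemma exists_sqr_between (n : nat) : (0 < n)%N -> exists S, (n <= S ^ 2 <= 4 * n)%N.
Proof.
move=> n0; have ex : exists S, (n <= S ^ 2)%N by exists n; rewrite -mulnn leq_pmulr.
case: (ex_minnP ex) => S nS Smin; exists S; rewrite nS /=.
have [S1|S1] := leqP S 1; first by rewrite (@leq_trans 1) ?muln_gt0 // (leq_exp2r S 1).
have : (S.-1 ^ 2 < n)%N by rewrite ltnNge; apply/negP => /Smin; lia.
nia.
Qed.

(** Integer form of the bound p^(1/2 + 4/k), raised to the power 2 k. *)
Lemma gs_pow_bound (k : nat) : (8 < k)%N -> exists2 C, (0 < C)%N &
  forall p, prime p -> (C < p)%N -> (gs p ^ (2 * k) <= C * p ^ (k + 8))%N.
Proof.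
move=> k8; have k0 : (0 < k)%N by lia.
have [B B0 HB] := submultiplicative_bound k0.
(* The factors come from 10^(2 k), S^(2 k) <= (4 p)^k and D^(4 k) <= B^4 p^8. The same constant is
   the threshold for p in [D4]. *)
exists (400 ^ k * B ^ 4)%N; first by rewrite muln_gt0 !expn_gt0 B0.
move=> p pp pC; have p0 := prime_gt0 pp; have p1 := prime_gt1 pp.
have [S /andP[pS Sp]] := exists_sqr_between p0.
have HB1 := HB (fun n => size (divisors n)) isT.
have {}HB1 n : (0 < n)%N -> (size (divisors n) ^ k <= B * n)%N.
  by apply: HB1 => r e m pr _ rm m0; apply: size_divisors_pfactor_mul.
have HB2 := HB (fun n => 2 ^ size (primes n))%N isT.
have {}HB2 n : (0 < n)%N -> ((2 ^ size (primes n)) ^ k <= B * n)%N.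
  by apply: HB2 => r e m pr e0 _ m0; apply: exp2_size_primes_pfactor_mul.
pose D := maxn (2 ^ size (primes p.-1)) (\max_(n < p ^ 2) size (divisors n)).
have DB : (D ^ k <= B * p ^ 2)%N.
  have maxP a b : (a ^ k <= B * p ^ 2 -> b ^ k <= B * p ^ 2 -> maxn a b ^ k <= B * p ^ 2)%N.
    by case: (leqP a b).
  apply: (maxP).
    apply: leq_trans (HB2 p.-1 _) _; first by rewrite -subn1 subn_gt0.
    by rewrite leq_mul2l; apply/orP; right; nia.
  (* The index 0 contributes 1, since [divisors 0] is [[:: 1]]. *)
  elim/big_ind: _ => [|a b|[[|n] /= nP] _]; [by rewrite exp0n|exact: maxP|by rewrite /= exp1n muln_gt0 B0 expn_gt0 p0|].
  by apply: leq_trans (HB1 n.+1 isT) _; rewrite leq_mul2l (ltnW nP) orbT.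
pose M := (4 * D ^ 2 * S).+1.
have D0 : (0 < D)%N by rewrite leq_max expn_gt0.
have S0 : (0 < S)%N by case: S pS {Sp M} => //; rewrite exp0n // leqNgt p0.
(* As k > 8, p > 400^k B^4 gives 400^k B^4 p^8 < p^9 <= p^k. *)
have D4 : (D ^ 4 * 400 < p)%N.
  rewrite -(@ltn_exp2r _ _ k) // expnMn -expnM [(4 * k)%N]mulnC expnM.
  apply: (@leq_ltn_trans ((B * p ^ 2) ^ 4 * 400 ^ k)).
    by rewrite leq_mul2r leq_exp2r ?DB ?orbT.
  apply: (@leq_trans (p * p ^ 8)); last by rewrite -expnS leq_exp2l.
  have -> : ((B * p ^ 2) ^ 4 * 400 ^ k = 400 ^ k * B ^ 4 * p ^ 8)%N.
    by rewrite expnMn -expnM; lia.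
  by rewrite ltn_pmul2r // expn_gt0 p0.
(* Ensures 2 M < p, as 2 M = 8 D^2 S + 2 <= 10 D^2 S. *)
have DS : (10 * D ^ 2 * S < p)%N.
  rewrite -(@ltn_exp2r _ _ 2) //.
  apply: (@leq_ltn_trans (D ^ 4 * 400 * p)); last by rewrite -mulnn ltn_pmul2r.
  have -> : ((10 * D ^ 2 * S) ^ 2 = D ^ 4 * 100 * S ^ 2)%N by nia.
  have -> : (D ^ 4 * 400 * p = D ^ 4 * 100 * (4 * p))%N by lia.
  by rewrite leq_mul2l Sp orbT.
have D2S : (0 < D ^ 2 * S)%N by rewrite muln_gt0 expn_gt0 D0.
have gsM : (gs p <= 2 * M)%N.
  apply: (@gs_le_double p D S) => //; first exact: leq_maxl.
  - move=> n /andP[n0 np]; apply: leq_trans (leq_maxr _ _).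
    by have := @leq_bigmax _ (fun i : 'I_(p ^ 2) => size (divisors i)) (Ordinal np).
  - by rewrite /M; lia.
have gsD : (gs p <= 10 * D ^ 2 * S)%N by apply: leq_trans gsM _; rewrite /M; lia.
apply: (@leq_trans ((10 * D ^ 2 * S) ^ (2 * k))); first by rewrite leq_exp2r // muln_gt0.
have -> : ((10 * D ^ 2 * S) ^ (2 * k) = 100 ^ k * (D ^ k) ^ 4 * (S ^ 2) ^ k)%N.
  rewrite expnM; have -> : ((10 * D ^ 2 * S) ^ 2 = 100 * D ^ 4 * S ^ 2)%N by nia.
  by rewrite !expnMn !(expnS (D ^ k)) expn0 muln1.
apply: (@leq_trans (100 ^ k * (B * p ^ 2) ^ 4 * (4 * p) ^ k)).
  by rewrite leq_mul ?leq_exp2r // leq_mul ?leq_exp2r.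
have -> : ((B * p ^ 2) ^ 4 = B ^ 4 * p ^ 8)%N by rewrite expnMn -expnM.
by apply: eq_leq; rewrite -[400%N]/(100 * 4)%N !(expnMn _ _ k) expnD; lia.
Qed.

(** * Passage to real exponents *)

Local Open Scope classical_set_scope.
Local Open Scope ring_scope.

Theorem theorem1p1 (R : realType) (eps : R) (heps : 0 < eps) :
  exists2 C : R, 0 < C &
    exists2 x0 : R, 1 < x0 &
      forall (x : R) (p : nat), x0 <= x -> prime p -> x <= p%:R <= 2 * x ->
        (gs p)%:R <= C * (p%:R `^ (2^-1 + eps) * ln p%:R).
Proof.
(* The exponent to bound is (k + 8) / (2 k) = 1/2 + 4 / k. *)
have [k k8 keps] : exists2 k, (8 < k)%N & 4 / k%:R <= eps.
  have /andP[_ lt] : (Num.truncn (4 / eps))%:R <= 4 / eps < (Num.truncn (4 / eps)).+1%:R.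
    by apply: truncn_itv; rewrite divr_ge0 // ltW.
  exists (9 + Num.truncn (4 / eps))%N; first by rewrite leq_addr.
  rewrite ler_pdivrMr ?ltr0n // mulrC -ler_pdivrMr //; apply: ltW.
  by apply: (lt_le_trans lt); rewrite ler_nat; lia.
have [B B0 HB] := gs_pow_bound k8.
have ln2 : 0 < ln 2 :> R by rewrite ln_gt0 // ltr1n.
have k0 : k%:R != 0 :> R by rewrite pnatr_eq0 -lt0n (leq_ltn_trans _ k8).
have kk0 : (2 * k)%:R != 0 :> R by rewrite natrM mulf_neq0 // pnatr_eq0.
pose e : R := (2 * k)%:R^-1.
(* The 2 k-th root of B, divided by ln 2 since ln p >= ln 2. *)
exists (B%:R `^ e / ln 2); first by rewrite divr_gt0 // powR_gt0 // ltr0n.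
(* From p >= x >= B + 2 follows p > B, as [gs_pow_bound] demands. *)
exists B.+2%:R; first by rewrite ltr1n.
move=> x p Bx pp /andP[xp _].
have Bp : (B.+2 <= p)%N by rewrite -(ler_nat R) (le_trans Bx).
have p0 : 0 < p%:R :> R by rewrite ltr0n prime_gt0.
have gsB : (gs p)%:R <= B%:R `^ e * p%:R `^ (2^-1 + eps).
  have -> : (gs p)%:R = ((gs p)%:R ^+ (2 * k)) `^ e :> R.
    by rewrite -powR_mulrn // -powRrM mulfV ?powRr1.
  apply: (@le_trans _ _ ((B%:R * p%:R ^+ (k + 8)) `^ e)).
    apply: ge0_ler_powR; rewrite ?nnegrE ?invr_ge0 ?ler0n ?mulr_ge0 ?exprn_ge0 //.
    by rewrite -!natrX -natrM ler_nat HB // ltnW.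
  rewrite powRM ?exprn_ge0 // ler_wpM2l ?powR_ge0 // -powR_mulrn // -powRrM.
  apply: ler_powR; first by rewrite ler1n prime_gt0.
  have -> : (k + 8)%:R * e = 2^-1 + 4 / k%:R by rewrite /e natrM natrD; field.
  by rewrite lerD2l.
apply: (le_trans gsB); rewrite -mulrA ler_wpM2l ?powR_ge0 // mulrCA.
rewrite ler_peMr ?powR_ge0 // mulrC ler_pdivlMr // mul1r ler_ln ?posrE //.
by rewrite ler_nat prime_gt1.
Qed.
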